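(* Let $\mathcal{Q}$ be a convex quadratic set $$\mathcal{Q} = \{x \in \mathbb{R}^n : Wx \le w, \ x^{\mathsf T} H x + h^{\mathsf T} x \le \eta\},$$ where $W \in \mathbb{Q}^{m \times n}$, $w \in \mathbb{Q}^m$, $H \in \mathbb{Q}^{n \times n}$ is symmetric positive semidefinite, $h \in \mathbb{Q}^n$, and $\eta \in \mathbb{Q}$. Assume $$\bar\eta := \min\{x^{\mathsf T} H x + h^{\mathsf T} x : Wx \le w\} = \eta \quad \text{and} \quad \tilde\eta := \min\{x^{\mathsf T} H x + h^{\mathsf T} x : x \in \mathbb{R}^n\} = \eta.$$ Then $\mathcal{Q}$ is nonempty and not full-dimensional. Furthermore, there is a polynomial time algorithm that finds an affine subspace $\mathcal{A}$ of $\mathbb{R}^n$ such that $\mathcal{Q} = \{x \in \mathbb{R}^n : Wx \le w\} \cap \mathcal{A}$.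
   Context: A convex set in $\mathbb{R}^n$ is full-dimensional if its affine hull is $\mathbb{R}^n$ (equivalently, if it has positive volume). The algorithm's input is $W,w,H,h,\eta$, and polynomial time means polynomial in the size (number of bits of the standard binary encoding) of this rational input data.
   Formalization: The claim that Q is not full-dimensional is proved only for H ≠ 0, since for H = 0, h = 0, η = 0 the set Q is just {x : Wx ≤ w}, which may be full-dimensional; nonemptiness and the algorithm are proved for every H. *)

(* Defs.v *)
From HB Require Import structures.
From mathcomp Require Import all_boot all_order all_algebra.
From mathcomp Require Import boolp classical_sets reals.
From Stdlib Require Import BinNums.
Set Implicit Arguments.
Unset Strict Implicit.
Unset Printing Implicit Defensive.
Import Order.TTheory GRing.Theory Num.Theory.

Local Open Scope classical_set_scope.
Local Open Scope ring_scope.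

Section Geometry.
Variable R : realType.

Definition ratmx m n (A : 'M[rat]_(m, n)) : 'M[R]_(m, n) := map_mx ratr A.

Definition polyhedron m n (W : 'M[rat]_(m, n)) (w : 'cV[rat]_m) :
    set 'cV[R]_n :=
  [set x | forall i, (ratmx W *m x) i 0 <= ratmx w i 0].

Definition quad n (H : 'M[rat]_n) (h : 'cV[rat]_n) (x : 'cV[R]_n) : R :=
  (x^T *m ratmx H *m x) 0 0 + ((ratmx h)^T *m x) 0 0.

Definition quadratic_set m n (W : 'M[rat]_(m, n)) (w : 'cV[rat]_m)
    (H : 'M[rat]_n) (h : 'cV[rat]_n) (eta : rat) : set 'cV[R]_n :=
  [set x | polyhedron W w x /\ quad H h x <= ratr eta].

Definition psdmx n (H : 'M[rat]_n) : Prop :=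
  forall x : 'cV[R]_n, 0 <= (x^T *m ratmx H *m x) 0 0.

(* [v = min E]: in particular the minimum exists and is attained. *)
Definition is_minimum (E : set R) (v : R) : Prop := E v /\ lbound E v.

Definition affine_set n (S : set 'cV[R]_n) : Prop :=
  forall (x y : 'cV[R]_n) (t : R), S x -> S y -> S ((1 - t) *: x + t *: y).

Definition affine_subspace n (S : set 'cV[R]_n) : Prop :=
  S !=set0 /\ affine_set S.

Definition affine_hull n (S : set 'cV[R]_n) : set 'cV[R]_n :=
  [set x | forall T : set 'cV[R]_n, affine_set T -> S `<=` T -> T x].

Definition full_dimensional n (S : set 'cV[R]_n) : Prop :=
  affine_hull S = setT.

Definition linear_solutions k n (A : 'M[rat]_(k, n)) (b : 'cV[rat]_k) :
    set 'cV[R]_n :=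
  [set x | ratmx A *m x = ratmx b].

End Geometry.
Arguments polyhedron R [m n] W w _.
Arguments quadratic_set R [m n] W w H h eta _.
Arguments psdmx R [n] H.
Arguments linear_solutions R [k n] A b _.

(* The alphabet for rational data: binary digits, the minus sign, the fraction
   bar, and terminators for matrix entries, rows and matrices. *)
Inductive symbol :=
  | Bit of bool | Minus | Slash | EndEntry | EndRow | EndMatrix.

Definition symbol_code (s : symbol) : bool + 'I_5 :=
  match s with
  | Bit b => inl b
  | Minus => inr (inord 0)
  | Slash => inr (inord 1)
  | EndEntry => inr (inord 2)
  | EndRow => inr (inord 3)
  | EndMatrix => inr (inord 4)
  end.

Definition symbol_decode (c : bool + 'I_5) : symbol :=
  match c with
  | inl b => Bit b
  | inr i => nth Minus [:: Minus; Slash; EndEntry; EndRow; EndMatrix] i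
  end.

Lemma symbol_codeK : cancel symbol_code symbol_decode.
Proof. by case=> //=; rewrite inordK. Qed.

HB.instance Definition _ := Finite.copy symbol (can_type symbol_codeK).

(* Most significant bit first; 0 is the single digit 0. *)
Fixpoint pos_bits (p : positive) : seq bool :=
  match p with
  | xH => [:: true]
  | xO q => rcons (pos_bits q) false
  | xI q => rcons (pos_bits q) true
  end.

Definition nat_bits (n : nat) : seq bool :=
  if bin_of_nat n is Npos p then pos_bits p else [:: false].

Definition encode_nat (n : nat) : seq symbol := map Bit (nat_bits n).

Definition encode_int (z : int) : seq symbol :=
  (if z < 0 then [:: Minus] else [::]) ++ encode_nat (absz z).

(* [numq q / denq q] is the reduced fraction with positive denominator. *)
Definition encode_rat (q : rat) : seq symbol :=
  encode_int (numq q) ++ Slash :: encode_int (denq q).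

(* Row by row. The number of columns is not recorded when there are no rows; it
   is then known from the square matrix [H] of [encode_input]. *)
Definition encode_mx m n (A : 'M[rat]_(m, n)) : seq symbol :=
  flatten [seq flatten [seq rcons (encode_rat (A i j)) EndEntry
                       | j <- enum 'I_n] ++ [:: EndRow]
          | i <- enum 'I_m] ++ [:: EndMatrix].

Definition encode_input m n (W : 'M[rat]_(m, n)) (w : 'cV[rat]_m)
    (H : 'M[rat]_n) (h : 'cV[rat]_n) (eta : rat) : seq symbol :=
  encode_mx W ++ encode_mx w ++ encode_mx H ++ encode_mx h ++ encode_rat eta.

Definition encode_system k n (A : 'M[rat]_(k, n)) (b : 'cV[rat]_k) :
    seq symbol :=
  encode_mx A ++ encode_mx b.

(* Deterministic Turing machines with finitely many one-way infinite tapes.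
   A cell holds [None] (blank), an input/output symbol, or a symbol of the
   machine's own finite work alphabet. *)
Section TuringMachine.
Variable Sigma : finType.

Inductive move := Left | Stay | Right.

Definition cell (Gamma : finType) : Type := option (Sigma + Gamma).

Record machine := Machine {
  last_tape : nat;  (* the machine has [last_tape.+1] tapes *)
  state : finType;
  work : finType;
  start : state;
  halting : pred state;
  delta : state -> {ffun 'I_last_tape.+1 -> cell work} ->
          state * ('I_last_tape.+1 -> cell work * move)
}.

Record config (M : machine) := Config {
  cur_state : state M;
  contents : 'I_(last_tape M).+1 -> nat -> cell (work M);
  head_pos : 'I_(last_tape M).+1 -> nat
}.

(* Moving left from cell 0 has no effect. *)
Definition move_head (d : move) (p : nat) : nat :=
  match d with Left => p.-1 | Stay => p | Right => p.+1 end.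

Definition word_tape (Gamma : finType) (s : seq Sigma) : nat -> cell Gamma :=
  nth None [seq Some (inl x) | x <- s].

Definition init (M : machine) (s : seq Sigma) : config M :=
  {| cur_state := start M;
     contents := fun i => if i == ord0 then word_tape (work M) s
                          else fun=> None;
     head_pos := fun=> 0%N |}.

Definition step (M : machine) (c : config M) : config M :=
  if halting (cur_state c) then c else
  let r := delta (cur_state c) [ffun i => contents c i (head_pos c i)] in
  {| cur_state := r.1;
     contents := fun i p => if p == head_pos c i then (r.2 i).1
                            else contents c i p;
     head_pos := fun i => move_head (r.2 i).2 (head_pos c i) |}.

(* Started on tape 0 holding [s], [M] halts after at most [t] steps with the
   last tape holding exactly [o]; a halted configuration is a fixpoint of
   [step]. *)
Definition computes_within (M : machine) (s o : seq Sigma) (t : nat) : Prop :=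
  let c := iter t (@step M) (init M s) in
  halting (cur_state c) /\ contents c ord_max =1 word_tape (work M) o.

End TuringMachine.

(* Main.v *)
From HB Require Import structures.
Require Import Defs.
From mathcomp Require Import all_boot all_order all_algebra ring lra.
From mathcomp Require Import boolp classical_sets reals.
Import Order.TTheory GRing.Theory Num.Theory.

(* Since [eta] is the unconstrained minimum of the convex function
   [x^T H x + h^T x], its sublevel set at [eta] is the set of minimizers, i.e.
   the affine space where the gradient [2 H x + h] vanishes. Hence the subspace
   [H x = - h / 2] does the job, and computing it takes no linear algebra: a
   streaming transducer copies [H] and rewrites each entry of [h]. Halving and
   negating a reduced fraction is a matter of flipping the sign and, according
   to the parity of the numerator, dropping its last bit or appending a zero bit
   to the denominator. *)

(* [Entry] is the start of an entry or row terminator of [h]; [Held b] delays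
   the numerator bit [b] until it is known whether it is the last one.
   [PutSlash] and [DoubleDen] treat odd numerators; [CopyTail] finishes an
   entry whose remaining symbols are unchanged. *)
Variant phase :=
  | SkipW | SkipRhs | CopyH | Entry | FirstDigit | Held of bool | PutSlash
  | DoubleDen | CopyTail | Halt.

Definition phase_code (q : phase) : bool + 'I_9 :=
  match q with
  | Held b => inl b
  | SkipW => inr (inord 0)
  | SkipRhs => inr (inord 1)
  | CopyH => inr (inord 2)
  | Entry => inr (inord 3)
  | FirstDigit => inr (inord 4)
  | PutSlash => inr (inord 5)
  | DoubleDen => inr (inord 6)
  | CopyTail => inr (inord 7)
  | Halt => inr (inord 8)
  end.

Definition phase_decode (c : bool + 'I_9) : phase :=
  match c with
  | inl b => Held b
  | inr i => nth Halt [:: SkipW; SkipRhs; CopyH; Entry; FirstDigit; PutSlash;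
                          DoubleDen; CopyTail; Halt] i
  end.

Lemma phase_codeK : cancel phase_code phase_decode.
Proof. by case=> //=; rewrite inordK. Qed.

HB.instance Definition _ := Finite.copy phase (can_type phase_codeK).

(** The result is the next phase, whether the input head advances, and the symbol to append, if any.
    The last case covers [Halt] and ill-formed input. *)
Definition action (q : phase) (s : option symbol) :
    phase * bool * option symbol :=
  match q, s with
  | SkipW, Some x =>
      (if x is EndMatrix then SkipRhs else SkipW, true, None)
  | SkipRhs, Some x =>
      (if x is EndMatrix then CopyH else SkipRhs, true, None)
  | CopyH, Some x =>
      (if x is EndMatrix then Entry else CopyH, true, Some x)
  | Entry, Some (Bit b) =>
      if b then (FirstDigit, false, Some Minus)
      else (CopyTail, true, Some (Bit false))
  | Entry, Some Minus => (FirstDigit, true, None)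
  | Entry, Some EndRow => (Entry, true, Some EndRow)
  | Entry, Some EndMatrix => (Halt, true, Some EndMatrix)
  | FirstDigit, Some (Bit b) => (Held b, true, None)
  | Held b, Some (Bit c) => (Held c, true, Some (Bit b))
  | Held b, Some Slash =>
      if b then (PutSlash, false, Some (Bit true))
      else (CopyTail, true, Some Slash)
  | PutSlash, Some Slash => (DoubleDen, true, Some Slash)
  | DoubleDen, Some (Bit b) => (DoubleDen, true, Some (Bit b))
  | DoubleDen, Some EndEntry => (CopyTail, false, Some (Bit false))
  | CopyTail, Some x =>
      (if x is EndEntry then Entry else CopyTail, true, Some x)
  | _, _ => (Halt, false, None)
  end.

Definition scanned (v : cell symbol void) : option symbol :=
  if v is Some (inl x) then Some x else None.

(** Tape 0 is only read, from left to right; tape 1 is only appended to. *)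
Definition gradient_machine : machine symbol :=
  @Machine symbol 1 phase void SkipW (pred1 Halt) (fun q v =>
    let: (q', advance, out) := action q (scanned (v ord0)) in
    (q', fun i =>
      if i == ord0 then (v i, if advance then Right else Stay)
      else if out is Some x then (Some (inl x), Right) else (v i, Stay))).

(** * Simulation of the machine by snapshots, and its halting time *)

Definition snapshot : Type := phase * seq symbol * seq symbol.

Definition snapshot_step (c : snapshot) : snapshot :=
  let: (q, rest, out) := c in
  let: (q', advance, x) := action q (ohead rest) in
  (q', if advance then behead rest else rest, out ++ seq_of_opt x).

(** [rest] is the unread input; the bound on the head makes the [take] exactly as long as the head
    position. *)
Definition represents (s : seq symbol) (a : snapshot)
    (c : config gradient_machine) : Prop :=
  let: (q, rest, out) := a in
  cur_state c = q /\
  [/\ contents c ord0 =1 word_tape void s,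
      s = take (head_pos c ord0) s ++ rest /\ (head_pos c ord0 <= size s)%N,
      contents c ord_max =1 word_tape void out
    & head_pos c ord_max = size out].

Lemma represents_init s :
  represents s (SkipW, s, [::]) (init gradient_machine s).
Proof.
split=> //; split=> //=; first by rewrite take0.
by move=> p; rewrite /word_tape /= nth_nil.
Qed.

Lemma word_tape_rcons (out : seq symbol) x p :
  word_tape void (rcons out x) p =
    if p == size out then Some (inl x) else word_tape void out p.
Proof.
rewrite /word_tape map_rcons nth_rcons size_map.
case: ltngtP => // lt_p; rewrite nth_default ?size_map//; exact: ltnW.
Qed.

Lemma represents_step s a c :
  represents s a c -> represents s (snapshot_step a) (step c).
Proof.
case: a => [[q rest] out] [qE [in_tape [sE le_s] out_tape headE]].
rewrite /snapshot_step /step.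
case: ifPn => [|nhalt].
  by rewrite /= qE => /eqP qH; rewrite qH /= cats0; split=> //; rewrite qE.
set v := finfun _.
have vE : scanned (v ord0) = ohead rest.
  rewrite ffunE in_tape sE /word_tape map_cat nth_cat size_map size_takel//.
  by rewrite ltnn subnn; case: (rest).
rewrite /= qE vE.
case actE: (action q (ohead rest)) => [[q' adv] x] /=.
(* Advancing only over an actual symbol keeps the head from passing the end of the input. *)
have rest_advance : adv -> exists y r, rest = y :: r.
  case: (rest) actE => [|y r] /=; last by exists y, r.
  by case: q {qE} => [|||||[]||||] //= [_ <-].
split=> //=; split=> /=.
- move=> p; rewrite ffunE in_tape.
  by case: eqP => // ->.
- case: adv rest_advance {actE} => [/(_ isT)[y [r rE]]|_] //=.
  move: sE; rewrite rE /= => sE; have lt_s : (head_pos c ord0 < size s)%N.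
    by rewrite sE size_cat size_takel//= -addn1 leq_add2l.
  split=> //; rewrite (take_nth y)// -cats1 -catA /= [in nth _ _ _]sE.
  by rewrite nth_cat size_takel// ltnn subnn.
- move=> p; rewrite ffunE !out_tape headE.
  case: x {actE} => [x|] /=; first by rewrite cats1 word_tape_rcons.
  by rewrite cats0; case: eqP => // ->.
- case: x {actE} => [x|] /=; rewrite headE ?cats0 ?cats1 ?size_rcons//.
Qed.

(* Weighted so that it also decreases on the steps that leave the input head in
   place. *)
Definition fuel (a : snapshot) : nat :=
  let: (q, rest, _) := a in
  (size rest).*2 +
    match q with Halt => 0 | Entry | Held _ | DoubleDen => 2 | _ => 1 end.

(** Advancing pays two units while the phase weight rises by at most one; a step that stays in place
    moves to a lighter phase. *)
Lemma fuel_step a : a.1.1 <> Halt -> fuel (snapshot_step a) < fuel a.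
Proof.
case: a => [[[|||||[]||||] [|[[]|||||] rest]] out] //= _;
  by rewrite ?addn0 ?addn1 ?addn2 ?doubleS; do ?[exact: leqnn | apply: leqW].
Qed.

Lemma iter_halt k rest out :
  iter k snapshot_step (Halt, rest, out) = (Halt, rest, out).
Proof. by elim: k => //= k ->; rewrite /= cats0. Qed.

Lemma fuel_iter a : (iter (fuel a) snapshot_step a).1.1 = Halt.
Proof.
have [n] := ubnP (fuel a); elim: n a => // n IH a; rewrite ltnS => le_n.
have [aH|/eqP/fuel_step lt_a] := eqVneq a.1.1 Halt.
  by case: a aH {le_n} => -[q rest] out /= ->; rewrite iter_halt.
have := IH _ (leq_trans lt_a le_n); rewrite -(subnK lt_a) iterD iterSr.
by case: (iter _ _ _) => -[q rest] out /= ->; rewrite iter_halt.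
Qed.

(** Step counts are forgotten here, since [fuel] bounds the running time separately. *)
Definition reaches (a b : snapshot) := exists t, iter t snapshot_step a = b.

Lemma reaches_refl a : reaches a a. Proof. by exists 0. Qed.

Lemma reaches_trans a b c : reaches a b -> reaches b c -> reaches a c.
Proof. by move=> [t <-] [u <-]; exists (u + t); rewrite iterD. Qed.

Lemma reaches_step a b : reaches (snapshot_step a) b -> reaches a b.
Proof. by case=> t <-; exists t.+1; rewrite iterSr. Qed.

(** The initial snapshot has fuel [(size s).*2.+1], so the run has halted by then. Halted snapshots
    no longer change, so the output reached at any time is the one at time [t]. *)
Lemma computes_reaches s rest o t :
  reaches (SkipW, s, [::]) (Halt, rest, o) -> (size s).*2.+1 <= t ->
  computes_within gradient_machine s o t.
Proof.
case=> u uE le_t.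
have tE : iter t snapshot_step (SkipW, s, [::]) = (Halt, rest, o).
  move: (fuel_iter (SkipW, s, [::])); rewrite [fuel _]/= addn1.
  move: le_t => /subnK <-; rewrite iterD.
  case E: (iter (_.+1) _ _) => [[q r] o'] /= qH.
  rewrite qH in E *; rewrite iter_halt; move: uE E.
  case: (leqP u (size s).*2.+1) => [|/ltnW] /subnK <-; rewrite iterD.
    by move=> ->; rewrite iter_halt.
  by move=> + E; rewrite E iter_halt.
have : represents s (iter t snapshot_step (SkipW, s, [::]))
         (iter t (@step _ _) (init gradient_machine s)).
  elim: t {le_t tE} => [|t IH]; first exact: represents_init.
  exact: represents_step.
by rewrite tE /computes_within; case=> -> [_ _ outE _]; split=> //; exact: eqxx.
Qed.

Local Open Scope classical_set_scope.
Local Open Scope ring_scope.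

(** * Binary digits and encodings of reduced fractions *)

Lemma nat_bits_double n : (0 < n)%N -> nat_bits n.*2 = rcons (nat_bits n) false.
Proof.
rewrite /nat_bits -[n]bin_of_natK; case: (bin_of_nat n) => //= p _.
rewrite -NatTrec.doubleE (nat_of_binK (BinNums.Npos p)).
by rewrite (nat_of_binK (BinNums.Npos (BinNums.xO p))).
Qed.

Lemma nat_bits_odd n : odd n -> exists u, nat_bits n = rcons u true.
Proof.
rewrite /nat_bits -{1}[n]bin_of_natK; case: (bin_of_nat n) => //= -[p|p|] /=.
- by exists (pos_bits p).
- by rewrite NatTrec.doubleE odd_double.
- by exists [::].
Qed.

(** The leading one lets the first digit tell a nonzero fraction from zero. *)
Lemma nat_bits_lead n : (0 < n)%N -> exists u, nat_bits n = true :: u.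
Proof.
rewrite /nat_bits -{1}[n]bin_of_natK; case: (bin_of_nat n) => //= p _.
elim: p => [p [u uE]|p [u uE]|] /=; last by exists [::].
  by exists (rcons u true); rewrite uE.
by exists (rcons u false); rewrite uE.
Qed.

Lemma encode_rat_frac (s : bool) (a d : nat) :
    (0 < a)%N -> (0 < d)%N -> coprime a d ->
  encode_rat ((-1) ^+ s * (a%:R / d%:R)) =
    nseq s Minus ++ encode_nat a ++ Slash :: encode_nat d.
Proof.
move=> a_gt0 d_gt0 co_ad; rewrite /encode_rat /encode_int.
have -> : (-1) ^+ s * (a%:R / d%:R) = ((-1) ^+ s * a%:Z)%:~R / d%:Z%:~R :> rat.
  by rewrite mulrA rmorphM rmorphXn rmorphN rmorph1.
have co : coprime `|(-1) ^+ s * a%:Z| `|d%:Z| by rewrite abszMsign.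
rewrite coprimeq_num // coprimeq_den //.
rewrite gtr0_sg ?ltz_nat // mul1r eqz_nat eqn0Ngt d_gt0 /=.
rewrite abszMsign -catA; congr (_ ++ _).
by rewrite mulr_sign_lt0 eqz_nat -lt0n a_gt0 addbF; case: (s).
Qed.

Lemma rat_frac (q : rat) : q != 0 -> exists (s : bool) (a d : nat),
  [/\ (0 < a)%N, (0 < d)%N, coprime a d & q = (-1) ^+ s * (a%:R / d%:R)].
Proof.
move=> q0; exists (numq q < 0), `|numq q|%N, `|denq q|%N.
rewrite !absz_gt0 numq_eq0 q0 denq_eq0 coprime_num_den; split=> //.
rewrite -[LHS]divq_num_den {1}[numq q]intEsign rmorphM rmorphXn rmorphN rmorph1.
by rewrite mulrA -[denq q in LHS]absz_denq.
Qed.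

(** * Rewriting one entry of [h] *)

Lemma held_bits b u rest out :
  reaches (Held b, map Bit u ++ rest, out)
    (Held (last b u), rest, out ++ map Bit (belast b u)).
Proof.
elim: u b out => [|c u IH] b out /=.
  by rewrite cats0; exact: reaches_refl.
apply: reaches_step=> /=; rewrite cats1 -cat_rcons; exact: IH.
Qed.

(** Output lags one bit behind input, so the last numerator bit is still undecided when the slash
    comes up. *)
Lemma first_digit_bits u b rest out :
  reaches (FirstDigit, map Bit (rcons u b) ++ rest, out)
    (Held b, rest, out ++ map Bit u).
Proof.
case: u => [|c u] /=; apply: reaches_step => /=; rewrite cats0.
  exact: reaches_refl.
have := held_bits c (rcons u b) rest out.
by rewrite last_rcons belast_rcons.
Qed.

Lemma double_den_bits u rest out :
  reaches (DoubleDen, map Bit u ++ EndEntry :: rest, out)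
    (CopyTail, EndEntry :: rest, out ++ map Bit (rcons u false)).
Proof.
elim: u out => [|c u IH] out /=; apply: reaches_step => /=.
  exact: reaches_refl.
rewrite cats1 -(cat_rcons (Bit c)); exact: IH.
Qed.

Lemma copy_tail w rest out : EndEntry \notin w ->
  reaches (CopyTail, w ++ EndEntry :: rest, out)
    (Entry, rest, out ++ rcons w EndEntry).
Proof.
elim: w out => [|x w IH] out /=.
  by move=> _; apply: reaches_step; exact: reaches_refl.
rewrite inE negb_or => /andP[x_neq nw]; apply: reaches_step.
have -> : snapshot_step (CopyTail, x :: w ++ EndEntry :: rest, out) =
    (CopyTail, w ++ EndEntry :: rest, rcons out x).
  by case: x x_neq => [b|||||]; rewrite ?eqxx //= cats1.
by rewrite -(cat_rcons x); exact: IH.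
Qed.

Lemma encode_nat_notin x n :
  (if x is Bit _ then false else true) -> x \notin encode_nat n.
Proof. by move=> nb; apply/mapP => -[b _ xE]; rewrite xE in nb. Qed.

(** For a reduced fraction with numerator [a] and denominator [d], halving gives a/(2d) if [a] is
    odd and (a/2)/d if [a] is even. Both are again reduced, so no gcd is computed. *)
Lemma entry_step q rest out :
  reaches (Entry, encode_rat q ++ EndEntry :: rest, out)
    (Entry, rest, out ++ rcons (encode_rat (- 2^-1 * q)) EndEntry).
Proof.
have [-> | q0] := eqVneq q 0.
  (* Zero is written 0/1 and is copied unchanged. *)
  rewrite mulr0; apply: reaches_step.
  have := @copy_tail [:: Slash; Bit true] rest (rcons out (Bit false)).
  rewrite cat_rcons -cats1; apply.
  by rewrite !inE; apply/norP; split; apply/eqP.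
have [s [a [d [a_gt0 d_gt0 co_ad ->]]]] := rat_frac _ q0.
(* Sign flip: a minus is swallowed; otherwise one is written while the leading digit stays
   unread. *)
have signed w r : reaches (Entry, (nseq s Minus ++ encode_nat a) ++ r, w)
    (FirstDigit, encode_nat a ++ r, w ++ nseq (~~ s) Minus).
  case: s => /=; apply: reaches_step; first exact: reaches_refl.
  rewrite /encode_nat; have [u ->] := nat_bits_lead _ a_gt0.
  exact: reaches_refl.
rewrite encode_rat_frac // -!catA catA.
apply: reaches_trans (signed _ _) _.
have [a_odd|a_even] := boolP (odd a).
  have -> : - 2^-1 * ((-1) ^+ s * (a%:R / d%:R)) =
      (-1) ^+ (~~ s) * (a%:R / d.*2%:R) :> rat.
    by rewrite signrN -mul2n natrM; field; rewrite pnatr_eq0 -lt0n.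
  rewrite encode_rat_frac ?double_gt0 //; last first.
    by rewrite -muln2 coprimeMr co_ad coprimen2.
  rewrite /encode_nat nat_bits_double //; have [u ->] := nat_bits_odd _ a_odd.
  apply: reaches_trans (first_digit_bits _ _ _ _) _.
  (* The held 1 is released at the slash without moving, then the slash is copied. *)
  do 2!apply: reaches_step => /=.
  apply: reaches_trans (double_den_bits _ _ _) _.
  apply: reaches_step => /=.
  rewrite -!cats1 !map_cat /= -!catA /= -!catA; exact: reaches_refl.
have aE : a = a./2.*2 by rewrite -[LHS]odd_double_half (negPf a_even).
move: a_gt0 co_ad; rewrite {}aE; move: a./2 => c.
rewrite double_gt0 => c_gt0; rewrite -muln2 coprimeMl => /andP[co_cd _].
have -> : - 2^-1 * ((-1) ^+ s * ((c * 2)%:R / d%:R)) =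
    (-1) ^+ (~~ s) * (c%:R / d%:R) :> rat.
  by rewrite signrN natrM; field; rewrite pnatr_eq0 -lt0n.
rewrite encode_rat_frac // muln2 {1}/encode_nat nat_bits_double //.
apply: reaches_trans (first_digit_bits _ _ _ _) _.
(* The held 0 is dropped at the slash, which halves the numerator. *)
apply: reaches_step => /=.
apply: reaches_trans (copy_tail _ _ _ _) _; first exact: encode_nat_notin.
rewrite -!cats1 -!catA; exact: reaches_refl.
Qed.

(** * Runs on whole matrices and on the full input *)

Lemma encode_cV n (h : 'cV[rat]_n) :
  encode_mx h = flatten [seq encode_rat (h i 0) ++ [:: EndEntry; EndRow]
                        | i <- enum 'I_n] ++ [:: EndMatrix].
Proof.
congr (flatten _ ++ _); apply: eq_map => i.
by rewrite enum_ordSl enum_ord0 /= cats0 cat_rcons.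
Qed.

Lemma column_steps n (h : 'cV[rat]_n) rest out :
  reaches (Entry, encode_mx h ++ rest, out)
    (Halt, rest, out ++ encode_mx (- 2^-1 *: h)).
Proof.
(* Only [entry_step] matters about [encode_rat]; abstracting it keeps [/=] from unfolding it. *)
rewrite !encode_cV; have := entry_step; move: encode_rat => e stepE.
elim: (enum 'I_n) out => [|i r IH] out /=.
  by apply: reaches_step; exact: reaches_refl.
rewrite -!catA; apply: reaches_trans (stepE _ _ _) _.
apply: reaches_step => /=; rewrite mxE -cats1 -!catA catA.
have := IH (out ++ e (- 2^-1 * h i 0) ++ [:: EndEntry; EndRow]).
by rewrite -!catA.
Qed.

(** The terminator lets a scan find the end of a matrix without knowing its dimensions. *)
Lemma encode_mxE m n (A : 'M[rat]_(m, n)) :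
  exists2 w, encode_mx A = w ++ [:: EndMatrix] & EndMatrix \notin w.
Proof.
rewrite /encode_mx; eexists; first reflexivity.
have notin_rat q : EndMatrix \notin encode_rat q.
  have nS : EndMatrix != Slash by apply/eqP.
  have nM : EndMatrix != Minus by apply/eqP.
  rewrite /encode_rat /encode_int !(mem_cat, inE) !negb_or !encode_nat_notin //.
  by case: ifP; case: ifP; rewrite ?inE nS ?nM.
apply/flattenP => -[w /mapP[i _ ->]]; rewrite mem_cat inE => /orP[|/eqP//].
case/flattenP=> v /mapP[j _ ->]; rewrite mem_rcons inE => /orP[/eqP//|].
exact/negP/notin_rat.
Qed.

Lemma skip_mx q q' m n (A : 'M[rat]_(m, n)) rest out :
    (forall x, action q (Some x) =
       (if x is EndMatrix then q' else q, true, None)) ->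
  reaches (q, encode_mx A ++ rest, out) (q', rest, out).
Proof.
move=> qE; have [w ->] := encode_mxE _ _ A.
elim: w => [|x w IH] /=.
  by move=> _; apply: reaches_step; rewrite /= qE cats0; exact: reaches_refl.
rewrite inE negb_or => /andP[x_neq nw]; apply: reaches_step.
case: x x_neq => [b|||||]; rewrite ?eqxx //= => _;
  by rewrite qE cats0; exact: IH.
Qed.

Lemma copy_mx m n (A : 'M[rat]_(m, n)) rest out :
  reaches (CopyH, encode_mx A ++ rest, out) (Entry, rest, out ++ encode_mx A).
Proof.
have [w ->] := encode_mxE _ _ A.
elim: w out => [|x w IH] out /=.
  by move=> _; apply: reaches_step; exact: reaches_refl.
rewrite inE negb_or => /andP[x_neq nw]; apply: reaches_step.
case: x x_neq => [b|||||]; rewrite ?eqxx //= => _;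
  by rewrite (cats1 out) -(cat_rcons _ out); exact: IH.
Qed.

Lemma gradient_machineP m n (W : 'M[rat]_(m, n)) w (H : 'M[rat]_n) h eta t :
  ((size (encode_input W w H h eta)).*2.+1 <= t)%N ->
  computes_within gradient_machine (encode_input W w H h eta)
    (encode_system H (- 2^-1 *: h)) t.
Proof.
(* The encoding of [eta] is left unread. *)
apply: (@computes_reaches _ (encode_rat eta)).
apply: reaches_trans (skip_mx SkipW SkipRhs _ _ _ _ _ _) _ => //.
apply: reaches_trans (skip_mx SkipRhs CopyH _ _ _ _ _ _) _ => //.
apply: reaches_trans (copy_mx _ _ _ _ _) _.
exact: column_steps.
Qed.

(** * Minimizers of a convex quadratic function *)

Section Minimizers.
Variables (R : realType) (n : nat) (H : 'M[rat]_n) (h : 'cV[rat]_n).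
Hypotheses (Hsym : H^T = H) (Hpsd : psdmx R H).

Definition grad (x : 'cV[R]_n) : 'cV[R]_n := 2 *: (ratmx R H *m x) + ratmx R h.

(** Taylor expansion, exact at second order for a quadratic; symmetry of [H] merges the two cross
    terms. *)
Lemma quad_line (x y : 'cV[R]_n) (t : R) :
  quad H h (x + t *: y) = quad H h x + t * (y^T *m grad x) 0 0
    + t ^+ 2 * (y^T *m ratmx R H *m y) 0 0.
Proof.
have sym (u v : 'cV[R]_n) :
    (u^T *m ratmx R H *m v) 0 0 = (v^T *m ratmx R H *m u) 0 0.
  rewrite -[in LHS](trmxK (u^T *m _ *m v)) mxE !trmx_mul trmxK.
  by rewrite /ratmx map_trmx Hsym mulmxA.
have lin (u : 'cV[R]_n) : ((ratmx R h)^T *m u) 0 0 = (u^T *m ratmx R h) 0 0.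
  by rewrite -[in LHS](trmxK (_ *m u)) mxE trmx_mul trmxK.
have e (A B : 'M[R]_1) : (A + B) 0 0 = A 0 0 + B 0 0 by rewrite mxE.
have z c (A : 'M[R]_1) : (c *: A) 0 0 = c * A 0 0 by rewrite mxE.
rewrite /quad /grad !lin !linearD /= !linearZ /= !mulmxDl.
rewrite -!scalemxAl !(e, z) (sym x y) !mulmxA; ring.
Qed.

(** Where the gradient vanishes, the expansion leaves only a nonnegative quadratic term. Conversely,
    a short move against a nonzero gradient strictly decreases the value. *)
Lemma grad_eq0_minimizer (x : 'cV[R]_n) :
  grad x = 0 <-> forall y, quad H h x <= quad H h y.
Proof.
split=> [gx0 y | xmin].
  rewrite -[y in leRHS](subrK x) addrC -[y - x]scale1r quad_line gx0 mulmx0.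
  by rewrite mxE mulr0 addr0 expr1n mul1r lerDl.
have normE (v : 'cV[R]_n) : (v^T *m v) 0 0 = \sum_i (v i 0) ^+ 2.
  by rewrite mxE; apply: eq_bigr => i _; rewrite mxE expr2.
have [N0|] := eqVneq ((grad x)^T *m grad x) 0.
  apply/matrixP => i j; rewrite (ord1 j) [RHS]mxE; apply/eqP.
  rewrite -sqrf_eq0; move/matrixP/(_ 0 0)/eqP: N0.
  rewrite normE mxE psumr_eq0 => [/allP/(_ i)|].
    by rewrite mem_index_enum => /(_ isT).
  by move=> k _; exact: sqr_ge0.
rewrite [_ *m _]mx11_scalar -scalemx1 scaler_eq0 negb_or => /andP[N0 _].
(* With g the gradient, N = g^T g and c = g^T H g, moving by -N/(c+1) times g lowers the value by
   exactly (N/(c+1))^2; the added 1 covers c = 0. *)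
have := Hpsd (grad x); have := xmin (x + (- (((grad x)^T *m grad x) 0 0 /
  (((grad x)^T *m ratmx R H *m grad x) 0 0 + 1))) *: grad x).
have Nge0 : 0 <= ((grad x)^T *m grad x) 0 0.
  by rewrite normE sumr_ge0 // => k _; exact: sqr_ge0.
rewrite quad_line; move: N0 Nge0.
set N := (_ *m grad x) 0 0; set c := (_ *m grad x) 0 0 => N0 Nge0.
rewrite -addrA lerDl => le0 c0; exfalso.
have Ngt0 : 0 < N by rewrite lt_def N0.
have cgt0 : 0 < c + 1 by rewrite ltr_wpDl.
have : 0 < - (- (N / (c + 1)) * N + (- (N / (c + 1))) ^+ 2 * c).
  have -> : - (- (N / (c + 1)) * N + (- (N / (c + 1))) ^+ 2 * c) =
      (N / (c + 1)) ^+ 2 by field; rewrite gt_eqF.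
  by rewrite exprn_gt0 // divr_gt0.
lra.
Qed.

Lemma quad_min_iff_grad_eq0 (x x0 : 'cV[R]_n) :
  (forall y, quad H h x0 <= quad H h y) ->
  quad H h x <= quad H h x0 <-> grad x = 0.
Proof.
move=> x0min; rewrite grad_eq0_minimizer.
by split=> [xx0 y|]; [exact: le_trans (x0min y) | apply].
Qed.

Lemma linear_solutions_grad (x : 'cV[R]_n) :
  linear_solutions R H (- 2^-1 *: h) x <-> grad x = 0.
Proof.
rewrite /linear_solutions /grad /= /ratmx map_mxZ rmorphN fmorphV rmorph_nat.
split=> [->|/eqP].
  by rewrite scalerA mulrN divff ?pnatr_eq0// scaleN1r addNr.
rewrite addr_eq0 => /eqP /(congr1 ( *:%R 2^-1)).
by rewrite scalerA mulVf ?pnatr_eq0// scale1r scalerN scaleNr.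
Qed.

(** At 0 the gradient is [h], so [h] vanishes; at the unit vectors it then gives twice the columns
    of [H]. *)
Lemma grad_const0 : (forall x, grad x = 0) -> H = 0.
Proof.
move=> g0; apply: (@map_mx_inj _ _ (ratr : rat -> R)); rewrite map_mx0.
have h0 : ratmx R h = 0 by have := g0 0; rewrite /grad mulmx0 scaler0 add0r.
apply/matrixP=> i j; have := g0 (delta_mx j 0).
rewrite /grad h0 addr0 => /eqP; rewrite scaler_eq0 pnatr_eq0 /=.
by rewrite -colE => /eqP/matrixP/(_ i 0); rewrite !mxE.
Qed.

End Minimizers.

(** * Dimension of the quadratic set and the output subspace *)

Lemma affine_linear_solutions (R : realType) k n (A : 'M[rat]_(k, n)) b :
  affine_set (linear_solutions R A b).
Proof.
move=> x y t; rewrite /linear_solutions /= => Ax Ay.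
by rewrite mulmxDr -!scalemxAr Ax Ay -scalerDl subrK scale1r.
Qed.

(* [H != 0] is only needed for the second conclusion, which fails when
   H = 0, h = 0, eta = 0 and the polyhedron is full-dimensional. *)
Theorem lemma2 (R : realType) :
  (forall (m n : nat) (W : 'M[rat]_(m, n)) (w : 'cV[rat]_m)
          (H : 'M[rat]_n) (h : 'cV[rat]_n) (eta : rat),
     H^T = H -> psdmx R H ->
     is_minimum [set quad H h x | x in polyhedron R W w] (ratr eta) ->
     is_minimum [set quad H h x | x in [set: 'cV[R]_n]] (ratr eta) ->
     quadratic_set R W w H h eta !=set0 /\
     (H != 0 -> ~ full_dimensional (quadratic_set R W w H h eta))) /\
  (exists (M : machine symbol) (p : {poly nat}),
   forall (m n : nat) (W : 'M[rat]_(m, n)) (w : 'cV[rat]_m)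
          (H : 'M[rat]_n) (h : 'cV[rat]_n) (eta : rat),
     H^T = H -> psdmx R H ->
     is_minimum [set quad H h x | x in polyhedron R W w] (ratr eta) ->
     is_minimum [set quad H h x | x in [set: 'cV[R]_n]] (ratr eta) ->
     exists (k : nat) (A : 'M[rat]_(k, n)) (b : 'cV[rat]_k),
       [/\ computes_within M (encode_input W w H h eta) (encode_system A b)
             p.[size (encode_input W w H h eta)],
           affine_subspace (linear_solutions R A b)
         & quadratic_set R W w H h eta =
           polyhedron R W w `&` linear_solutions R A b]).
Proof.
(* Common core of both claims: the sublevel set at [eta] is the nonempty zero set of the
   gradient. *)
have minE n (H : 'M[rat]_n) (h : 'cV[rat]_n) eta : H^T = H -> psdmx R H ->
    is_minimum [set quad H h x | x in [set: 'cV[R]_n]] (ratr eta) ->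
    (exists x0 : 'cV[R]_n, grad _ _ H h x0 = 0) /\
    forall x : 'cV[R]_n, quad H h x <= ratr eta <-> grad _ _ H h x = 0.
  move=> Hsym Hpsd [[x0 _ x0E] lb].
  have x0min (y : 'cV[R]_n) : quad H h x0 <= quad H h y.
    by rewrite x0E; apply: lb; exists y.
  split; first by exists x0; apply/grad_eq0_minimizer.
  by move=> x; rewrite -x0E; exact: quad_min_iff_grad_eq0.
split.
  move=> m n W w H h eta Hsym Hpsd [[x Wx xE] _] /minE[]// _ quadE; split.
    by exists x; split=> //; rewrite xE.
  (* The affine hull lies in the affine zero set of the gradient; if it were everything, the
     gradient would vanish identically, forcing [H = 0]. *)
  move=> H0 full; move/negP: H0; apply; apply/eqP; apply: (grad_const0 R _ _ h).
  move=> y; apply/linear_solutions_grad.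
  have : affine_hull (quadratic_set R W w H h eta) y by rewrite full.
  apply; first exact: affine_linear_solutions.
  by move=> z [_ /quadE gz]; apply/linear_solutions_grad.
(* The polynomial is the fuel of the initial snapshot as a function of the input size. *)
exists gradient_machine, (2 *: 'X + 1%:P) => m n W w H h eta Hsym Hpsd _.
move=> /minE[]// [x0 gx0] quadE; exists n, H, (- 2^-1 *: h); split.
- by apply: gradient_machineP; rewrite !hornerE -mul2n -addn1; exact: leqnn.
- split; last exact: affine_linear_solutions.
  by exists x0; apply/linear_solutions_grad.
- apply/seteqP; split=> x [Wx xE]; split=> //.
    by apply/linear_solutions_grad/quadE.
  by apply/quadE/linear_solutions_grad.
Qed.
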